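(* Let $-\infty<a<b<\infty$ and let $n\ge1$ be an integer. The nodes of the Poincaré quadrature of $H^1(a,b)$ with $n$ nodes are equal to the zeros in $[a,b]$ of the Poincaré basis function $\varphi_n$.
   Context: Here $\mu$ is the uniform probability distribution on $[a,b]$, and $H^1(a,b)=H^1(\mu)$. The Poincaré basis of $\mu$ is given by the $L^2(\mu)$-normalized eigenfunctions of $\varphi''=-\lambda\varphi$ on $[a,b]$ with $\varphi'(a)=\varphi'(b)=0$, ordered by increasing eigenvalue: $\varphi_0=1$ and $\varphi_m(x)=\sqrt2\cos(m\omega(x-a))$ for $m\ge1$, with $\omega=\pi/(b-a)$. The Poincaré quadrature with $n$ nodes is the unique quadrature, consisting of $n$ nodes $x_1,\dots,x_n\in[a,b]$ and positive weights $w_1,\dots,w_n$, that is exact for $\varphi_0,\dots,\varphi_{2n-1}$, i.e. $\int_a^b\varphi_m\,d\mu=\sum_{i=1}^n w_i\varphi_m(x_i)$ for $0\le m\le 2n-1$ (existence and uniqueness are known because the Poincaré basis is, up to signs, a Tchebytchev system). *)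

(* Defs.v *)
From HB Require Import structures.
From mathcomp Require Import all_boot all_order all_algebra.
From mathcomp Require Import all_classical all_reals all_analysis.

Set Implicit Arguments.
Unset Strict Implicit.
Unset Printing Implicit Defensive.

Import Order.TTheory GRing.Theory Num.Theory.
Import numFieldNormedType.Exports.

Local Open Scope classical_set_scope.
Local Open Scope ring_scope.

(* f'' = - lam f on [a, b] with f'(a) = f'(b) = 0 and f not identically zero
   on [a, b]. The witness g is f' on the closed interval: g is continuous up
   to the endpoints, so g a and g b are the one-sided derivatives of f there.
   The values of f outside [a, b] are irrelevant. *)
Definition neumann_eigenfunction (R : realType) (a b lam : R) (f : R -> R)
    : Prop :=
  (exists2 x, x \in `[a, b] & f x != 0) /\
  exists g : R -> R,
    [/\ derivable_oo_LRcontinuous f a b,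
        derivable_oo_LRcontinuous g a b,
        {in `]a, b[, forall x, f^`()%classic x = g x},
        {in `]a, b[, forall x, g^`()%classic x = - lam * f x}
      & g a = 0 /\ g b = 0].

(* The sequence lam lists all the eigenvalues in increasing order. They are
   simple, so strict monotonicity loses nothing and this determines each phi m
   on [a, b] up to sign: phi 0 = 1 and
   phi m = sqrt 2 * cos (m * pi / (b - a) * (x - a)) for 0 < m. *)
Definition poincare_basis (R : realType) (a b : R) (ab : a < b)
    (phi : nat -> R -> R) : Prop :=
  exists lam : nat -> R,
    [/\ {homo lam : i j / (i < j)%N >-> i < j},
        forall l f, neumann_eigenfunction a b l f -> exists m, l = lam m,
        forall m, neumann_eigenfunction a b (lam m) (phi m)
      & forall m, \int[uniform_prob ab]_(x in `[a, b]) (phi m x ^+ 2) = 1].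

Definition poincare_quadrature (R : realType) (a b : R) (ab : a < b)
    (phi : nat -> R -> R) (n : nat) (x w : 'I_n -> R) : Prop :=
  [/\ forall i, x i \in `[a, b],
      forall i, 0 < w i
    & forall m, (m <= 2 * n - 1)%N ->
        \int[uniform_prob ab]_(t in `[a, b]) phi m t
        = \sum_(i < n) w i * phi m (x i)].

(* Main.v *)
Require Import Defs.
From HB Require Import structures.
From mathcomp Require Import all_boot all_order all_algebra.
From mathcomp Require Import all_classical all_reals all_analysis.
From mathcomp Require Import measurable_realfun ring zify.

Set Implicit Arguments.
Unset Strict Implicit.
Unset Printing Implicit Defensive.

Import Order.TTheory GRing.Theory Num.Theory.
Import numFieldNormedType.Exports.

Local Open Scope classical_set_scope.
Local Open Scope ring_scope.

(** The substitution [theta = pi / (b - a) * (x - a)] turns the Poincare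
    quadrature into the Gauss-Chebyshev quadrature on [[0, pi]], whose nodes
    are the zeros of [cos (n theta)].

    Solving the Neumann problem explicitly shows that [phi m] is a nonzero
    multiple of [cos (m theta)] ([poincare_basisE]). The only integrals needed
    are those of [cos (m theta)] for the uniform law, which are [1] for [m = 0]
    and [0] otherwise ([integral_cos_uniform]). Thus the nodes [theta_i] and
    the weights [w_i] satisfy
      [\sum_i w_i cos (m theta_i) = (m == 0)] for [m <= 2 n - 1].

    Let [N t] be the product of the [cos t - cos theta_i]. It is a cosine sum
    with frequencies at most [n] and nonzero coefficient at frequency [n]
    ([prod_cosB_cos_sum]). Since it vanishes at all nodes, exactness makes it
    orthogonal to [cos (m t)] for [m < n], so that [N t = k cos (n t)] with
    [k <> 0] ([prod_cosB_nodes]). As cosine is injective on [[0, pi]], the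
    zeros of [N] there are exactly the nodes, and both inclusions follow. *)

(** * Cosine sums and the node polynomial *)

(** These sums are the polynomials of degree less than [n] in [cos t], written
    in the Chebyshev basis rather than in powers. *)
Definition cos_sum (R : realType) (c : nat -> R) (n : nat) (t : R) : R :=
  \sum_(j < n) c j * cos (j%:R * t).

Lemma mul_cos (R : realType) (s t : R) :
  cos s * cos t = (cos (s + t) + cos (s - t)) / 2.
Proof. by rewrite cosD cosB; field. Qed.

(** The number [j - m + (m - j)], with truncated subtractions, is the distance
    between [j] and [m]; cosine being even, this keeps all frequencies in
    [nat]. *)
Lemma mul_cos_nat (R : realType) (j m : nat) (t : R) :
  cos (j%:R * t) * cos (m%:R * t)
  = (cos ((j + m)%:R * t) + cos ((j - m + (m - j))%:R * t)) / 2.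
Proof.
rewrite mul_cos -mulrDl -natrD -mulrBl; congr ((_ + _) / _).
have [mj|/ltnW jm] := leqP m j.
  by rewrite -natrB// (eqP mj) addn0.
by rewrite -opprB mulNr cosN -natrB// (eqP jm).
Qed.

(** Multiplication by [cos t] sends frequency [j > 0] to half the sum of the
    frequencies [j + 1] and [j - 1], so it raises the degree by one and the top
    coefficient does not cancel. *)
Lemma cosB_cos_sum (R : realType) (c : nat -> R) (n : nat) (y : R) :
  exists2 d : nat -> R, (c n != 0 -> d n.+1 != 0) &
    forall t, (cos t - y) * cos_sum c n.+1 t = cos_sum d n.+2 t.
Proof.
elim: n => [|n [d _ dE]].
  exists (fun k => if k == 0%N then - y * c 0%N else c 0%N) => // t.
  by rewrite /cos_sum !big_ord_recr !big_ord0/= mul0r cos0 mul1r; ring.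
exists (fun k => if k == n.+2 then c n.+1 / 2 else
    d k + (if k == n then c n.+1 / 2 else 0)
        - (if k == n.+1 then y * c n.+1 else 0)).
  by rewrite eqxx => cn0; rewrite mulf_neq0// invr_neq0// pnatr_eq0.
move=> t; rewrite [cos_sum c _ _]big_ord_recr/= mulrDr -/(cos_sum c n.+1 t) dE.
have cE : cos t * cos (n.+1%:R * t)
          = (cos (n.+2%:R * t) + cos (n%:R * t)) / 2.
  by have := mul_cos_nat n.+1 1 t; rewrite mul1r mulrC addn1 subn1 addn0.
rewrite mulrBl [X in _ + (X - _) = _]mulrCA cE.
rewrite /cos_sum !big_ord_recr/= !eqxx !(ltn_eqF (ltnSn _)).
rewrite !(gtn_eqF (ltnSn _)) (ltn_eqF (ltnW (ltnSn _))).
rewrite [in RHS](eq_bigr (fun i : 'I_n => d i * cos (i%:R * t))); last first.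
  move=> i _; rewrite (ltn_eqF (ltn_ord i)) !ltn_eqF ?addr0 ?subr0//.
    exact: (leq_trans (ltn_ord i)).
  by apply: (leq_trans (ltn_ord i)); rewrite -addn2 leq_addr.
by field.
Qed.

Lemma prod_cosB_cos_sum (R : realType) (n : nat) (y : 'I_n -> R) :
  exists2 c : nat -> R, c n != 0 &
    forall t, \prod_(i < n) (cos t - y i) = cos_sum c n.+1 t.
Proof.
elim: n y => [|n IHn] y.
  exists (fun=> 1) => [|t]; first exact: oner_neq0.
  by rewrite big_ord0 /cos_sum big_ord_recr big_ord0/= mul0r cos0 mulr1 add0r.
have [c cn0 cE] := IHn (fun i => y (widen_ord (leqnSn n) i)).
have [d dn0 dE] := cosB_cos_sum c n (y ord_max).
by exists d => [|t]; [exact: dn0|rewrite big_ord_recr/= cE mulrC dE].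
Qed.

(** The Gauss quadrature argument. The product vanishes at every node, so its
    quadrature sum against [cos (m t)] is zero. For [m < n], all the
    frequencies in that sum are at most [2 n - 1], so exactness evaluates it
    through the orthogonality of the cosines: up to a nonzero factor it is the
    coefficient of [cos (m t)] in the product. Only the term of frequency [n]
    survives. *)
Lemma prod_cosB_nodes (R : realType) (n : nat) (theta w : 'I_n -> R) :
  (0 < n)%N ->
  (forall m, (m <= 2 * n - 1)%N ->
     \sum_(i < n) w i * cos (m%:R * theta i) = (m == 0)%:R) ->
  exists2 k : R, k != 0 &
    forall t, \prod_(i < n) (cos t - cos (theta i)) = k * cos (n%:R * t).
Proof.
move=> n_gt0 exact_w.
have [c cn0 cE] := prod_cosB_cos_sum (fun i => cos (theta i)).
exists (c n) => // t; rewrite cE /cos_sum big_ord_recr/= big1 ?add0r// => m _.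
suff -> : c m = 0 by rewrite mul0r.
have m_lt := ltn_ord m.
have : \sum_(i < n) w i * (cos_sum c n.+1 (theta i) * cos (m%:R * theta i)) = 0.
  apply: big1 => i _; rewrite -cE (bigD1 i)//= subrr.
  by rewrite !mul0r mulr0.
rewrite /cos_sum.
under eq_bigr do rewrite mulr_suml mulr_sumr.
(* Both frequencies [j + m] and [|j - m|] are at most [2 n - 1]. *)
rewrite exchange_big/= (eq_bigr (fun j : 'I_n.+1 =>
    c j * (((j + m == 0)%N%:R + (j == m :> nat)%:R) / 2))); last first.
  move=> j _; have j_le : (j <= n)%N by rewrite -ltnS.
  have -> : (j == m :> nat) = (j - m + (m - j) == 0)%N.
    by rewrite addn_eq0 !subn_eq0 -eqn_leq.
  rewrite -!exact_w; [|lia|lia].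
  rewrite -big_split/= mulr_suml mulr_sumr; apply: eq_bigr => i _.
  rewrite -mulrA mul_cos_nat; ring.
have m_ltS : (m < n.+1)%N := ltnW m_lt.
rewrite (bigD1 (Ordinal m_ltS))//= big1 ?addr0 => [|j jm].
  move/eqP; rewrite mulf_eq0 => /orP[/eqP//|].
  rewrite eqxx -natrD mulf_eq0 invr_eq0 !pnatr_eq0/= orbF.
  by rewrite addn_eq0 andbF.
have -> : (j == m :> nat) = false.
  by apply: contraNF jm => /eqP jm; apply/eqP/val_inj.
rewrite (_ : (j + m == 0)%N = false) ?addr0 ?mul0r ?mulr0//.
apply: contraNF jm; rewrite addn_eq0 => /andP[/eqP j0 /eqP m0].
by apply/eqP/val_inj; rewrite /= j0 m0.
Qed.

(** * Calculus and trigonometry preliminaries *)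

Lemma is_derive_continuous (R : realType) (h dh : R -> R) :
  (forall x, is_derive x (1 : R) h (dh x)) -> continuous h.
Proof.
by move=> dhE x; apply/differentiable_continuous/derivable1_diffP; case: (dhE x).
Qed.

Lemma is_derive_LRcontinuous (R : realType) (a b : R) (h dh : R -> R) :
  (forall x, is_derive x (1 : R) h (dh x)) -> derivable_oo_LRcontinuous h a b.
Proof.
move=> dhE; have h_cont := is_derive_continuous dhE.
by split => [x _//||];
  [exact/cvg_at_right_filter/h_cont|exact/cvg_at_left_filter/h_cont].
Qed.

Lemma is_derive_affine (R : realType) (h : R -> R) (s a x dh : R) :
  is_derive (s * (x - a)) (1 : R) h dh ->
  is_derive x (1 : R) (fun y => h (s * (y - a))) (s * dh).
Proof.
move=> dhx.
have dg : is_derive x (1 : R) (fun y => s * (y - a)) s.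
  rewrite (_ : (fun y => _) = s \*: (id - cst a)); last by [].
  by apply: is_derive_eq; rewrite subr0 /GRing.scale/= mulr1.
by rewrite mulrC; exact: (@is_derive1_comp R h (fun y => s * (y - a)) x dh s dhx dg).
Qed.

Lemma continuous_cos_affine (R : realType) (s a : R) :
  continuous (fun t : R => cos (s * (t - a))).
Proof.
exact: (is_derive_continuous
  (fun x => @is_derive_affine R cos s a x _ (is_derive_cos _))).
Qed.

Lemma is_derive_mull (R : realType) (h : R -> R) (c x dh : R) :
  is_derive x (1 : R) h dh -> is_derive x (1 : R) (fun y => c * h y) (c * dh).
Proof. exact: is_deriveZ. Qed.

(** Subtracting the multiple of [pi] just below [y] changes [sin y] by a sign
    only and lands in [[0, pi)], where the sine vanishes at [0] only. *)
Lemma sin_eq0_pi (R : realType) (y : R) : 0 <= y -> sin y = 0 ->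
  exists k : nat, y = k%:R * pi.
Proof.
move=> y0 siny0; exists (Num.truncn (y / pi)).
have pi0 : 0 < pi :> R := pi_gt0 R.
have ypi0 : 0 <= y / pi by rewrite divr_ge0// ltW.
have /andP[] := Num.Theory.truncn_itv ypi0.
set k := Num.truncn _.
rewrite ler_pdivlMr// ltr_pdivrMr// => ky yk.
apply/eqP; rewrite eq_le ky andbT leNgt; apply/negP => ltky.
have : 0 < sin (y - k%:R * pi).
  apply: sin_gt0_pi; rewrite subr_gt0 ltky ltrBlDr.
  by move: yk; rewrite -natr1 mulrDl mul1r addrC.
have : sin (y - k%:R * pi + pi *+ k) = 0 by rewrite -[pi *+ k]mulr_natl subrK.
rewrite (alternatingn (@sinDpi R)) => /eqP.
by rewrite mulf_eq0 signr_eq0/= => /eqP ->; rewrite ltxx.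
Qed.

Lemma sin_natpi (R : realType) (k : nat) : sin (k%:R * pi) = 0 :> R.
Proof.
by rewrite -[k%:R * pi]add0r mulr_natl (alternatingn (@sinDpi R)) sin0 mulr0.
Qed.

(** * Neumann eigenfunctions *)

Lemma derive_cst_on (R : realType) (a b : R) (f : R -> R) :
  {within `[a, b], continuous f} ->
  {in `]a, b[, forall x, is_derive x (1 : R) f 0} ->
  {in `[a, b], forall x, f x = f a}.
Proof.
move=> f_cont f'0 x /[!in_itv]/= /andP[ax xb].
apply/eqP; rewrite -subr_eq0.
have [y yax|//|y _ ->] := @MVT_segment R f (fun=> 0) a x ax; last by rewrite mul0r.
  by apply: f'0; move: yax; rewrite !in_itv/= => /andP[-> /lt_le_trans->].
by apply: continuous_subspaceW f_cont; exact: subset_itvl.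
Qed.

(** The left-hand side is, up to sign, the Wronskian of [f] and [q], where
    [q'' = - l q] and [p = - q'], so it is constant. Taking for [q] the explicit
    solutions of the equation replaces a uniqueness theorem for differential
    equations. The endpoints are reached by continuity, since [f] solves the
    equation in the open interval only. *)
Lemma neumann_wronskian (R : realType) (a b l : R) (f g p q : R -> R) :
  {within `[a, b], continuous f} -> {within `[a, b], continuous g} ->
  {in `]a, b[, forall x, is_derive x (1 : R) f (g x)} ->
  {in `]a, b[, forall x, is_derive x (1 : R) g (- l * f x)} ->
  (forall x, is_derive x (1 : R) q (- p x)) ->
  (forall x, is_derive x (1 : R) p (l * q x)) ->
  {in `[a, b], forall x, f x * p x + g x * q x = f a * p a + g a * q a}.
Proof.
move=> fc gc df dg dq dp.
apply: (@derive_cst_on R a b (f * p + g * q)) => [x|x xab]; last first.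
  apply: is_derive_eq (is_deriveD (is_deriveM (df x xab) (dp x))
    (is_deriveM (dg x xab) (dq x))) _.
  by rewrite /GRing.scale/=; ring.
by apply: continuousD; apply: continuousM;
  [exact: fc|exact/continuous_subspaceT/(is_derive_continuous dp)|
   exact: gc|exact/continuous_subspaceT/(is_derive_continuous dq)].
Qed.

(** The Wronskian identities with explicit solutions determine [f] from
    [f a] and [f' a = 0], and [f' b = 0] then selects [l]. For [l < 0] the two
    exponentials force [f b = 0], then [f a = 0] and [f = 0]; for [l = 0],
    [f' = 0]; for [l = s ^ 2 > 0], [f] is [f a * cos (s (x - a))] and the
    condition at [b] reads [sin (s (b - a)) = 0]. *)
Lemma neumann_eigenfunctionE (R : realType) (a b l : R) (f : R -> R) :
  a < b -> neumann_eigenfunction a b l f ->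
  exists2 k : nat, l = (k%:R * (pi / (b - a))) ^+ 2 &
    f a != 0 /\ {in `[a, b], forall x,
      f x = f a * cos (k%:R * (pi / (b - a)) * (x - a))}.
Proof.
move=> ab [[z zab fz] [g [fLR gLR f' g' [ga gb]]]].
have ba0 : 0 < b - a by rewrite subr_gt0.
have fc := derivable_oo_LRcontinuous_within fLR.
have gc := derivable_oo_LRcontinuous_within gLR.
have df : {in `]a, b[, forall x, is_derive x (1 : R) f (g x)}.
  move=> x xab; have [fd _ _] := fLR.
  by apply: DeriveDef; [exact: fd|rewrite -derive1E f'].
have dg : {in `]a, b[, forall x, is_derive x (1 : R) g (- l * f x)}.
  move=> x xab; have [gd _ _] := gLR.
  by apply: DeriveDef; [exact: gd|rewrite -derive1E g'].
have bab : b \in `[a, b] by rewrite in_itv/= lexx ltW.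
have W p q dq dp := @neumann_wronskian R a b l f g p q fc gc df dg dq dp.
have fa0 (c : R -> R) : {in `[a, b], forall x, f x = f a * c x} -> f a != 0.
  by move=> fE; apply: contra_neq fz => fa; rewrite fE// fa mul0r.
have [l0|l0|l0] := ltgtP l 0.
- pose s := Num.sqrt (- l).
  have s0 : 0 < s by rewrite sqrtr_gt0 oppr_gt0.
  have lE : l = - s ^+ 2 by rewrite sqr_sqrtr ?opprK// oppr_ge0 ltW.
  (* Both signs [r = s] and [r = - s] are used. *)
  have WE r : r ^+ 2 = s ^+ 2 -> {in `[a, b], forall x,
      f x * expR (- r * (x - a)) + g x * (r^-1 * expR (- r * (x - a))) = f a}.
    move=> r2.
    have r0 : r != 0.
      by apply/eqP => r0; move/eqP: r2; rewrite r0 expr0n/= eq_sym sqrf_eq0 gt_eqF.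
    pose q x := r^-1 * expR (- r * (x - a)).
    have dp x : is_derive x (1 : R) (fun y => expR (- r * (y - a))) (l * q x).
      apply: is_derive_eq (@is_derive_affine R expR (- r) a x _ (is_derive_expR _)) _.
      by rewrite lE -r2 /q; field.
    have dq x : is_derive x (1 : R) q (- expR (- r * (x - a))).
      apply: is_derive_eq
        (is_derive_mull r^-1 (@is_derive_affine R expR (- r) a x _ (is_derive_expR _))) _.
      by field.
    move=> x xab; rewrite (W _ _ dq dp x xab).
    by rewrite subrr mulr0 expR0 ga mul0r addr0 mulr1.
  have Wp := WE s erefl; have Wn := WE (- s) (sqrrN s).
  have fb0 : f b = 0.
    have := Wp b bab; rewrite -(Wn b bab) gb !mul0r !addr0 => /eqP.
    rewrite -subr_eq0 -mulrBr mulf_eq0 => /orP[/eqP//|].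
    rewrite subr_eq0 => /eqP/expR_inj/eqP.
    by rewrite opprK mulNr eq_sym -subr_eq0 opprK -mulr2n mulrn_eq0/= gt_eqF// mulr_gt0.
  have fa : f a = 0 by rewrite -(Wp b bab) fb0 gb !mul0r addr0.
  have := Wp z zab; have := Wn z zab; rewrite fa.
  move=> /eqP; rewrite mulrA -mulrDl mulf_eq0 (gt_eqF (expR_gt0 _)) orbF invrN mulrN.
  rewrite subr_eq0 => /eqP fgz /eqP.
  rewrite mulrA -mulrDl mulf_eq0 (gt_eqF (expR_gt0 _)) orbF -fgz -mulr2n mulrn_eq0/=.
  by rewrite (negbTE fz).
- pose s := Num.sqrt l.
  have s0 : 0 < s by rewrite sqrtr_gt0.
  have sN0 : s != 0 by rewrite gt_eqF.
  have lE : l = s ^+ 2 by rewrite sqr_sqrtr// ltW.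
  have dC x : is_derive x (1 : R) (fun y => cos (s * (y - a)))
    (s * - sin (s * (x - a))).
    exact: is_derive_affine.
  have dS x : is_derive x (1 : R) (fun y => sin (s * (y - a)))
    (s * cos (s * (x - a))).
    exact: is_derive_affine.
  have W1 : {in `[a, b], forall x,
      f x * cos (s * (x - a)) + g x * (- s^-1 * sin (s * (x - a))) = f a}.
    pose q x := - s^-1 * sin (s * (x - a)).
    have dp x : is_derive x (1 : R) (fun y => cos (s * (y - a))) (l * q x).
      by apply: is_derive_eq (dC x) _; rewrite lE /q; field.
    have dq x : is_derive x (1 : R) q (- cos (s * (x - a))).
      by apply: is_derive_eq (is_derive_mull (- s^-1) (dS x)) _; field.
    move=> x xab; rewrite (W _ _ dq dp x xab).
    by rewrite subrr mulr0 cos0 ga mul0r addr0 mulr1.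
  have W2 : {in `[a, b], forall x,
      f x * sin (s * (x - a)) + g x * (s^-1 * cos (s * (x - a))) = 0}.
    pose q x := s^-1 * cos (s * (x - a)).
    have dp x : is_derive x (1 : R) (fun y => sin (s * (y - a))) (l * q x).
      by apply: is_derive_eq (dS x) _; rewrite lE /q; field.
    have dq x : is_derive x (1 : R) q (- sin (s * (x - a))).
      by apply: is_derive_eq (is_derive_mull s^-1 (dC x)) _; field.
    move=> x xab; rewrite (W _ _ dq dp x xab).
    by rewrite subrr mulr0 sin0 ga mul0r addr0 mulr0.
  have fE : {in `[a, b], forall x, f x = f a * cos (s * (x - a))}.
    move=> x xab; rewrite -(W1 x xab); have := W2 x xab.
    move: (cos2Dsin2 (s * (x - a))).
    move: (cos _) (sin _) => C S CS W2x.
    transitivity (f x * (C ^+ 2 + S ^+ 2)); first by rewrite CS mulr1.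
    by rewrite -[RHS]addr0 -(mulr0 S) -W2x; ring.
  have fb : sin (s * (b - a)) = 0.
    have fbN0 : f b != 0.
      have := W1 b bab; rewrite gb mul0r addr0 => fab; apply: contra_neq (fa0 _ fE).
      by move=> fb; rewrite -fab fb mul0r.
    have /eqP := W2 b bab; rewrite gb mul0r addr0 mulf_eq0 (negbTE fbN0)/=.
    by move/eqP.
  have [k sk] := sin_eq0_pi (ltW (mulr_gt0 s0 ba0)) fb.
  have sE : s = k%:R * (pi / (b - a)) by rewrite mulrA -sk mulfK// gt_eqF.
  by exists k; rewrite -sE//; split => //; exact: fa0 fE.
- exists 0%N; first by rewrite mul0r expr0n.
  have gE : {in `[a, b], forall x, g x = 0}.
    move=> x xab; rewrite -ga; apply: (derive_cst_on gc) => // y yab.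
    by have := dg y yab; rewrite l0 oppr0 mul0r.
  have fE : {in `[a, b], forall x, f x = f a}.
    apply: (derive_cst_on fc) => y yab.
    by have := df y yab; rewrite gE//; exact: subset_itv_oo_cc yab.
  have fE' : {in `[a, b], forall x,
      f x = f a * cos (0%:R * (pi / (b - a)) * (x - a))}.
    by move=> x xab; rewrite !mul0r cos0 mulr1 fE.
  by split => //; exact: fa0 fE'.
Qed.

Lemma cos_neumann_eigenfunction (R : realType) (a b : R) (k : nat) : a < b ->
  neumann_eigenfunction a b ((k%:R * (pi / (b - a))) ^+ 2)
    (fun x => cos (k%:R * (pi / (b - a)) * (x - a))).
Proof.
move=> ab; set s := _ * (pi / _).
have sba : s * (b - a) = k%:R * pi.
  by rewrite /s -mulrA divfK// subr_eq0 gt_eqF.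
have dC x : is_derive x (1 : R) (fun y => cos (s * (y - a)))
    (s * - sin (s * (x - a))).
  exact: is_derive_affine.
have dS x : is_derive x (1 : R) (fun y => sin (s * (y - a)))
    (s * cos (s * (x - a))).
  exact: is_derive_affine.
have dS' x : is_derive x (1 : R) (fun y => - s * sin (s * (y - a)))
    (- s * (s * cos (s * (x - a)))).
  exact: is_derive_mull.
split; first by exists a; [rewrite in_itv/= lexx ltW|
  rewrite subrr mulr0 cos0 oner_neq0].
exists (fun x => - s * sin (s * (x - a))); split => [||x _|x _|].
- exact: is_derive_LRcontinuous dC.
- exact: is_derive_LRcontinuous dS'.
- by rewrite derive1E derive_val mulNr mulrN.
- by rewrite derive1E derive_val mulrA mulNr.
- by rewrite subrr mulr0 sin0 mulr0 sba sin_natpi mulr0.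
Qed.

(** An increasing [k] satisfies [i <= k i]. If [k j = m] and [k] fixes every
    index below [m], then [m <= j], whence [k m <= k j = m]. *)
Lemma strict_homo_surj_id (k : nat -> nat) :
  {homo k : i j / (i < j)%N >-> (i < j)%N} -> (forall m, exists i, k i = m) ->
  k =1 id.
Proof.
move=> k_homo k_surj m; elim/ltn_ind: m => m IHm.
have k_ge i : (i <= k i)%N.
  by elim: i => // i IHi; apply: leq_ltn_trans IHi (k_homo _ _ (ltnSn i)).
have [j kj] := k_surj m; have [jm|mj] := ltnP j m.
  by move: (jm); rewrite -{1}(IHm _ jm) kj ltnn.
apply/eqP; rewrite eqn_leq k_ge andbT -[X in (_ <= X)%N]kj.
move: mj; rewrite leq_eqVlt => /predU1P[->//|/k_homo/ltnW//].
Qed.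

(** The eigenvalues are exactly the squares [(k * pi / (b - a)) ^ 2], and an
    increasing enumeration of them can only be the obvious one, so the index
    [m] of [phi m] is its frequency. The factor [phi m a] takes the place of
    the normalisation [1] or [sqrt 2] and of the undetermined sign. *)
Lemma poincare_basisE (R : realType) (a b : R) (ab : a < b)
    (phi : nat -> R -> R) (m : nat) : poincare_basis ab phi ->
  phi m a != 0 /\ {in `[a, b], forall x,
    phi m x = phi m a * cos (m%:R * (pi / (b - a)) * (x - a))}.
Proof.
move=> [lam [lam_homo lam_all phi_eig _]].
have om0 : 0 < pi / (b - a) by rewrite divr_gt0 ?pi_gt0// subr_gt0.
have sq_lt (i j : nat) : ((i%:R * (pi / (b - a))) ^+ 2 < (j%:R * (pi / (b - a))) ^+ 2)
    = (i < j)%N.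
  have nn (p : nat) : p%:R * (pi / (b - a)) \in Num.nneg.
    by rewrite nnegrE mulr_ge0// ltW.
  by rewrite ltr_pXn2r ?nn// ltr_pM2r// ltr_nat.
have /choice[k kP] : forall m, exists k : nat,
    lam m = (k%:R * (pi / (b - a))) ^+ 2 /\ phi m a != 0 /\
    {in `[a, b], forall x,
      phi m x = phi m a * cos (k%:R * (pi / (b - a)) * (x - a))}.
  by move=> i; have [k lamk phik] := neumann_eigenfunctionE ab (phi_eig i); exists k.
have k_id : k =1 id.
  apply: strict_homo_surj_id => [i j /lam_homo|i].
    by rewrite (kP i).1 (kP j).1 sq_lt.
  have [j lamj] := lam_all _ _ (cos_neumann_eigenfunction i ab).
  exists j; move: lamj; rewrite (kP j).1 => /eqP; rewrite eq_le !leNgt !sq_lt.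
  by case: ltngtP.
by have := (kP m).2; rewrite k_id.
Qed.

(** * Cosine integrals for the uniform law *)

Lemma bounded_integrable_uniform (R : realType) (a b : R) (ab : a < b)
    (f : R -> R) (M : R) :
  measurable_fun setT f -> (forall x, `|f x| <= M) ->
  (uniform_prob ab).-integrable `[a, b] (EFin \o f).
Proof.
move=> mf fM.
apply: (@le_integrable _ _ _ _ _ _ _ (EFin \o cst M)) => //.
- exact/measurable_EFinP/measurable_funTS.
- by move=> x _; rewrite lee_fin (le_trans (fM x))// ler_norm.
- exact: finite_measure_integrable_cst.
Qed.

(** An infinite Lebesgue integral does not break the identity: both real-valued
    integrals are then [0] by convention. *)
Lemma Rintegral_uniform (R : realType) (a b : R) (ab : a < b) (f : R -> R) :
  measurable_fun setT f -> (forall x, 0 <= f x) ->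
  \int[uniform_prob ab]_(x in `[a, b]) f x
  = (b - a)^-1 * \int[lebesgue_measure]_(x in `[a, b]) f x.
Proof.
move=> mf f0.
rewrite Rintegral_mkcond /Rintegral integral_uniform; last 2 first.
- apply/measurable_EFinP; apply/(measurable_restrictT f) => //.
  exact: measurable_funTS.
- by move=> x; rewrite lee_fin patchE; case: ifP.
rewrite [X in (_ * X)%E](_ : _ = \int[lebesgue_measure]_(x in `[a, b]) (f x)%:E)%E;
  last by apply: eq_integral => x xab; rewrite patchE xab.
case: (\int[_]_(x in _) _)%E => [r||]; first by rewrite -EFinM.
- by rewrite gt0_muley ?lte_fin ?invr_gt0 ?subr_gt0//= mulr0.
- by rewrite gt0_muleNy ?lte_fin ?invr_gt0 ?subr_gt0//= mulr0.
Qed.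

Lemma integrable_cos_uniform (R : realType) (a b : R) (ab : a < b) (s : R) :
  (uniform_prob ab).-integrable `[a, b] (EFin \o (fun t => cos (s * (t - a)))).
Proof.
apply: (@bounded_integrable_uniform R a b ab _ 1) => [|x]; last exact: cos_max.
by apply: continuous_measurable_fun; exact: continuous_cos_affine.
Qed.

(** For [m > 0] the primitive [sin (s (t - a)) / s] vanishes at both endpoints.
    The reduction to Lebesgue measure applies to nonnegative integrands, so the
    function integrated there is [1 + cos]. *)
Lemma integral_cos_uniform (R : realType) (a b : R) (ab : a < b) (m : nat) :
  \int[uniform_prob ab]_(t in `[a, b]) cos (m%:R * (pi / (b - a)) * (t - a))
  = (m == 0)%:R.
Proof.
have int1 : \int[uniform_prob ab]_(t in `[a, b]) (1 : R) = 1.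
  by rewrite Rintegral_cst// mul1r /= /uniform_prob integral_uniform_pdf1.
case: m => [|m].
  by rewrite -[RHS]int1; apply: eq_Rintegral => t _; rewrite !mul0r cos0.
set s := _ * (pi / _).
have ba0 : 0 < b - a by rewrite subr_gt0.
have s0 : s != 0 by rewrite gt_eqF// mulr_gt0// divr_gt0// pi_gt0.
have sba : s * (b - a) = m.+1%:R * pi by rewrite /s -mulrA divfK// gt_eqF.
pose C t := cos (s * (t - a)).
have contC : continuous C by exact: continuous_cos_affine.
have cont1C : continuous (cst 1 + C).
  by move=> x; apply: continuousD; [exact: cst_continuous|exact: contC].
have int1C : \int[uniform_prob ab]_(t in `[a, b]) (1 + C t) = 1.
  rewrite Rintegral_uniform; last 2 first.
  - exact: continuous_measurable_fun.
  - by move=> x; rewrite -lerBlDl sub0r cos_geN1.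
  pose F t := t + s^-1 * sin (s * (t - a)).
  have dF x : is_derive x (1 : R) F (1 + C x).
    apply: is_derive_eq (is_deriveD (is_derive_id _ _)
      (is_derive_mull s^-1 (@is_derive_affine R sin s a x _ (is_derive_sin _)))) _.
    by rewrite mulKf.
  rewrite /Rintegral (@continuous_FTC2 _ _ F)//.
  - rewrite /F subrr mulr0 sin0 mulr0 addr0 sba sin_natpi mulr0 addr0/=.
    by rewrite mulVf// gt_eqF.
  - exact/continuous_subspaceT.
  - exact: is_derive_LRcontinuous dF.
  - by move=> x _; rewrite derive1E derive_val.
have iC := integrable_cos_uniform ab s.
have i1 : (uniform_prob ab).-integrable `[a, b] (EFin \o cst (1 : R)).
  exact: finite_measure_integrable_cst.
apply: (addrI 1); rewrite addr0 -[RHS]int1C -{1}int1.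
by rewrite -(RintegralD _ i1 iC).
Qed.

Lemma Rintegral_uniform_scaled_cos (R : realType) (a b : R) (ab : a < b)
    (m : nat) (c : R) (f : R -> R) :
  {in `[a, b], forall t, f t = c * cos (m%:R * (pi / (b - a)) * (t - a))} ->
  \int[uniform_prob ab]_(t in `[a, b]) f t = c * (m == 0)%:R.
Proof.
move=> fE; rewrite -(integral_cos_uniform ab) -RintegralZl//.
  by apply: eq_Rintegral => t /set_mem; exact: fE.
exact: integrable_cos_uniform.
Qed.

(** * Nodes of the Poincare quadrature *)

Theorem corollary1 (R : realType) (a b : R) (ab : a < b)
    (phi : nat -> R -> R) (hphi : poincare_basis ab phi)
    (n : nat) (hn : (1 <= n)%N) (x w : 'I_n -> R)
    (hq : poincare_quadrature ab phi x w) :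
  range x = [set t | t \in `[a, b] /\ phi n t = 0].
Proof.
have [xab _ exact_phi] := hq.
have ba0 : 0 < b - a by rewrite subr_gt0.
have om0 : 0 < pi / (b - a) by rewrite divr_gt0// pi_gt0.
pose angle t := pi / (b - a) * (t - a).
have angle_itv : {in `[a, b], forall t, angle t \in `[0, pi]}.
  move=> t /[!in_itv]/= /andP[at_ tb].
  rewrite mulr_ge0 ?(ltW om0) ?subr_ge0//=.
  by rewrite /angle mulrAC ler_pdivrMr// ler_pM2l ?pi_gt0// lerB.
have phiE m : phi m a != 0 /\
    {in `[a, b], forall t, phi m t = phi m a * cos (m%:R * angle t)}.
  have [phia phiE] := poincare_basisE m hphi; split=> // t /phiE ->.
  by rewrite /angle !mulrA.
have exact_cos m : (m <= 2 * n - 1)%N ->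
    \sum_(i < n) w i * cos (m%:R * angle (x i)) = (m == 0)%:R.
  move=> /exact_phi; have [phia {}phiE] := phiE m.
  have phiE' : {in `[a, b], forall t,
      phi m t = phi m a * cos (m%:R * (pi / (b - a)) * (t - a))}.
    by move=> t tab; rewrite phiE// /angle !mulrA.
  rewrite (Rintegral_uniform_scaled_cos ab phiE').
  move=> phiq; apply: (mulfI phia); rewrite phiq mulr_sumr.
  by apply: eq_bigr => i _; rewrite (phiE (x i))// mulrCA.
have [k k0 nodeE] := prod_cosB_nodes hn exact_cos.
apply/seteqP; split=> [_ [i _ <-]|t [tab]] /=.
  split=> //; rewrite (phiE n).2//; apply/eqP; rewrite mulf_eq0; apply/orP; right.
  have /esym/eqP := nodeE (angle (x i)).
  by rewrite (bigD1 i)//= subrr mul0r mulf_eq0 (negbTE k0).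
rewrite (phiE n).2// => /eqP; rewrite mulf_eq0 (negbTE (phiE n).1)/= => /eqP cos0.
have /eqP := nodeE (angle t); rewrite cos0 mulr0 prodf_seq_eq0.
move=> /hasP[i _ /=]; rewrite subr_eq0 => /eqP cos_eq; exists i => //.
have : angle (x i) = angle t.
  by apply: cos_inj; [exact: angle_itv|exact: angle_itv|rewrite cos_eq].
by move/(mulfI (lt0r_neq0 om0))/addIr.
Qed.
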